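(* Let $n,\lambda\ge2$ be even integers, $m=1+\frac{\lambda}{2}$, $\sigma>0$ and $\delta>0$. Let $\rho$, $c_0$, $k$ and the function $MN:[c_0,\infty)\to(0,\infty)$ be as defined in the context. If $\lambda-n-1\ge0$ and $k>0$, then the optimal choice of $c\in[c_0,\infty)$ is $c=c_0$, i.e. $MN$ attains its minimum over $[c_0,\infty)$ at $c_0=24\rho(m+1)\delta$.
   Context: The constant $\rho$ is: $\rho=1+\frac{s}{2m+3}$ with $s=\lceil\frac{n-\lambda-3}{2}\rceil$ if $n-\lambda>3$; $\rho=1$ if $n-\lambda\le3$. $c_0:=24\rho(m+1)\delta$, $k:=\frac{\sigma}{2}+\frac{\ln\frac23}{24\rho\delta}$. The MN function (for band-limited functions in $B_\sigma$, with the domain size $b_0$ not fixed) is $$MN(c)=\sqrt{8\rho}\,c^{\frac{\lambda-n-1}{4}}e^{c\left[\frac{\sigma}{2}+\frac{\ln\frac23}{24\rho\delta}\right]},\qquad c\in[c_0,\infty).$$ A value of $c\in[c_0,\infty)$ is called optimal if it minimizes $MN$ over $[c_0,\infty)$. *)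

(* Defs.v *)
From mathcomp Require Import all_boot all_order all_algebra.
From mathcomp Require Import reals sequences exp.

Set Implicit Arguments.
Unset Strict Implicit.
Unset Printing Implicit Defensive.

Import Order.TTheory GRing.Theory Num.Theory.
Local Open Scope ring_scope.

(* The differences n - lam below are taken in R, so they are never truncated. *)

Definition s_const (R : realType) (n lam : nat) : int :=
  Num.ceil ((n%:R - lam%:R - 3) / 2 : R).

Definition rho (R : realType) (n lam m : nat) : R :=
  if 3 < n%:R - lam%:R :> R
  then 1 + (s_const R n lam)%:~R / (2 * m%:R + 3)
  else 1.

Definition c0 (R : realType) (n lam m : nat) (delta : R) : R :=
  24 * rho R n lam m * (m%:R + 1) * delta.

Definition k_const (R : realType) (n lam m : nat) (sigma delta : R) : R :=
  sigma / 2 + ln (2 / 3) / (24 * rho R n lam m * delta).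

(* MN is total on R; only its values on [c0, +oo[ are meaningful, and for
   delta > 0 that interval lies in the positive reals, where the power
   function `^ is the usual real power. *)
Definition MN (R : realType) (n lam m : nat) (sigma delta : R) (c : R) : R :=
  Num.sqrt (8 * rho R n lam m) * c `^ ((lam%:R - n%:R - 1) / 4)
  * expR (c * k_const n lam m sigma delta).

Definition optimal (R : realType) (n lam m : nat) (sigma delta : R) (c : R)
    : Prop :=
  c0 n lam m delta <= c /\
  forall c' : R, c0 n lam m delta <= c' ->
    MN n lam m sigma delta c <= MN n lam m sigma delta c'.

(* Main.v *)
Require Import Defs.
From mathcomp Require Import all_boot all_order all_algebra.
From mathcomp Require Import reals sequences exp lra.

Set Implicit Arguments.
Unset Strict Implicit.
Unset Printing Implicit Defensive.

Import Order.TTheory GRing.Theory Num.Theory.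
Local Open Scope ring_scope.

(** The sign condition on [lam - n - 1] forces [rho = 1], so [c0] is positive. On the positive reals
    [MN] is then a positive constant times a power with nonnegative exponent times an exponential of
    positive rate, hence strictly increasing ([MN_lt]). The left endpoint of the interval is
    therefore its unique minimizer. *)

Lemma rho_eq1 (R : realType) (n lam m : nat) :
  0 <= lam%:R - n%:R - 1 :> R -> rho R n lam m = 1.
Proof. by move=> h; rewrite /rho ifF //; apply/negbTE; rewrite -leNgt; lra. Qed.

(** Strictness comes from the exponential factor alone; the power factor is only used as
    nondecreasing. Strictness is what yields uniqueness of the optimum. *)
Lemma MN_lt (R : realType) (n lam m : nat) (sigma delta x y : R) :
  0 <= lam%:R - n%:R - 1 :> R -> 0 < k_const n lam m sigma delta ->
  0 < x -> x < y -> MN n lam m sigma delta x < MN n lam m sigma delta y.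
Proof.
move=> hexp hk x0 xy; have y0 := lt_trans x0 xy.
have sqrt_gt0 : 0 < Num.sqrt (8 * rho R n lam m).
  by rewrite sqrtr_gt0 rho_eq1 // mulr1 ltr0n.
(* The intermediate value moves the power factor to [y] while the exponential stays at [x]. *)
apply: (@le_lt_trans _ _ (Num.sqrt (8 * rho R n lam m)
    * y `^ ((lam%:R - n%:R - 1) / 4) * expR (x * k_const n lam m sigma delta))).
  rewrite /MN ler_pM2r ?expR_gt0 // ler_pM2l //.
  by apply: ge0_ler_powR; rewrite ?nnegrE; [exact: divr_ge0 | exact: ltW ..].
by rewrite /MN ltr_pM2l ?mulr_gt0 ?powR_gt0 // ltr_expR ltr_pM2r.
Qed.

Theorem mainTheorem9 (R : realType) (n lam m : nat) (sigma delta : R)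
    (hn : (2 <= n)%N) (hn_even : ~~ odd n)
    (hlam : (2 <= lam)%N) (hlam_even : ~~ odd lam)
    (hm : m = (1 + lam./2)%N)
    (hsigma : 0 < sigma) (hdelta : 0 < delta)
    (hexp : 0 <= lam%:R - n%:R - 1 :> R)
    (hk : 0 < k_const n lam m sigma delta) :
  forall c : R, optimal n lam m sigma delta c <-> c = c0 n lam m delta.
Proof.
have c0_gt0 : 0 < c0 n lam m delta.
  by rewrite /c0 rho_eq1 // mulr1 !mulr_gt0 // ltr_wpDl.
move=> c; split=> [[c0_le min_c]|->].
  (* An optimal [c] beyond [c0] would be beaten by [c0] itself. *)
  apply/eqP; rewrite eq_le c0_le andbT leNgt; apply/negP => c0_lt.
  by have := MN_lt hexp hk c0_gt0 c0_lt; rewrite ltNge min_c.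
split=> // c'; rewrite le_eqVlt => /predU1P[<- //|c0_lt].
exact/ltW/MN_lt.
Qed.
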